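(* Let $\Omega$ be a finite set, $\mathcal{C}\le\mathbb{F}_q^\Omega$ a linear code, and $G\le\mathrm{PAut}(\mathcal{C})$ a subgroup whose order is coprime to $q$. Then $G^{(2)}\le\mathrm{PAut}(\mathcal{C})$.
   Context: For $g\in\mathrm{Sym}(\Omega)$ and $f\in\mathbb{F}_q^\Omega$, $f^g(\omega)=f(\omega^{g^{-1}})$; $\mathrm{PAut}(\mathcal{C})=\{g\in\mathrm{Sym}(\Omega):\mathcal{C}^g=\mathcal{C}\}$. A subgroup $G\le\mathrm{Sym}(\Omega)$ acts on $\Omega\times\Omega$ by $(\alpha,\beta)^g=(\alpha^g,\beta^g)$; the orbits are its 2-orbits. Two subgroups are 2-equivalent if they have the same 2-orbits, and the 2-closure $G^{(2)}$ is the subgroup of $\mathrm{Sym}(\Omega)$ generated by all subgroups 2-equivalent to $G$ (equivalently, the set of all permutations preserving every 2-orbit of $G$). *)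

(* Defs.v *)
From HB Require Import structures.
From mathcomp Require Import all_boot all_fingroup all_algebra.

Set Implicit Arguments.
Unset Strict Implicit.
Unset Printing Implicit Defensive.

Local Open Scope group_scope.

(* Permutations act on the right: the point w^g is [g w], and (g * h) w = h (g w). *)

Section PermutationAutomorphisms.

Variables (Omega : finType) (F : finFieldType).

(* [F^o] is F as a one-dimensional F-space, which makes {ffun Omega -> F^o}
   the coordinate space F_q^Omega as a vectType over F. *)
Definition word_act (f : {ffun Omega -> F^o}) (g : {perm Omega}) :
  {ffun Omega -> F^o} := [ffun w => f (g^-1 w)].

Lemma word_act1 : word_act^~ 1 =1 id.
Proof. by move=> f; apply/ffunP => w; rewrite ffunE invg1 perm1. Qed.

Lemma word_actM (f : {ffun Omega -> F^o}) : act_morph word_act f.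
Proof. by move=> g h; apply/ffunP => w; rewrite !ffunE invMg permM. Qed.

Canonical word_action := TotalAction word_act1 word_actM.

Definition code_act (C : {vspace {ffun Omega -> F^o}}) (g : {perm Omega}) :
  {set {ffun Omega -> F^o}} := [set word_act f g | f in C].

Definition PAut (C : {vspace {ffun Omega -> F^o}}) : {set {perm Omega}} :=
  [set g | code_act C g == [set f in C]].

Lemma PAut_group_set (C : {vspace {ffun Omega -> F^o}}) : group_set (PAut C).
Proof.
apply/group_setP; split=> [|g h]; rewrite !inE /code_act.
  apply/eqP/setP=> f; rewrite inE; apply/imsetP/idP => [[f' Cf' ->]|Cf].
    by rewrite word_act1.
  by exists f; rewrite ?word_act1.
move=> /eqP Cg /eqP Ch; apply/eqP; rewrite -[RHS]Ch.
transitivity [set word_act f h | f in [set word_act f g | f in C]].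
  by rewrite -imset_comp; apply: eq_imset => f /=; rewrite word_actM.
by rewrite Cg; apply/setP=> f; apply/imsetP/imsetP=> -[f' Cf' ->];
   exists f'; rewrite // inE in Cf' *.
Qed.
Canonical PAut_group C := Group (PAut_group_set C).

End PermutationAutomorphisms.

Section TwoClosure.

Variable Omega : finType.

Definition pair_act (x : Omega * Omega) (g : {perm Omega}) : Omega * Omega :=
  (g x.1, g x.2).

Lemma pair_act1 : pair_act^~ 1 =1 id.
Proof. by case=> a b; rewrite /pair_act !perm1. Qed.

Lemma pair_actM (x : Omega * Omega) : act_morph pair_act x.
Proof. by move=> g h; rewrite /pair_act !permM. Qed.

Canonical pair_action := TotalAction pair_act1 pair_actM.

Definition two_orbits (G : {set {perm Omega}}) : {set {set Omega * Omega}} :=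
  orbit pair_action G @: [set: Omega * Omega].

Definition two_equivalent (G H : {set {perm Omega}}) : bool :=
  two_orbits G == two_orbits H.

Definition two_closure (G : {set {perm Omega}}) : {set {perm Omega}} :=
  << \bigcup_(H : {group {perm Omega}} | two_equivalent G H) H >>.

Canonical two_closure_group (G : {set {perm Omega}}) :=
  Eval hnf in [group of two_closure G].

End TwoClosure.

(* Main.v *)
(** By coprimality, averaging a projection onto [C] over [G] (Maschke) gives a
    linear map [P] with values in [C] which commutes with [G] and restricts to
    the invertible scalar [#|G|] on [C].  The matrix of [P] is constant on the
    2-orbits of [G], so [P] also commutes with every permutation [h] preserving
    these 2-orbits; hence [#|G| f^h = P (f^h)] lies in [C] for every [f] in
    [C]. *)
Require Import Defs.
From HB Require Import structures.
From mathcomp Require Import all_boot all_fingroup all_algebra cyclic.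

Set Implicit Arguments.
Unset Strict Implicit.
Unset Printing Implicit Defensive.

Import GRing.Theory.
Local Open Scope ring_scope.

(** The additive group of [F] has order [#|F|], so [#|F|] vanishes in [F]; if [n] vanished too, a
    Bezout relation would give 1 = 0. *)
Lemma natr_coprime_neq0 (F : finFieldType) (n : nat) :
  coprime n #|F| -> n%:R != 0 :> F.
Proof.
move=> con; apply/eqP=> n0.
have F0 : #|F|%:R = 0 :> F.
  by rewrite -FinRing.zmodXgE -cardsT expg_cardG ?inE.
have Fgt0 : (0 < #|F|)%N by apply/card_gt0P; exists 0.
have [a _ /dvdnP[k /(congr1 (fun m => m%:R : F))]] := Bezoutl n Fgt0.
rewrite gcdnC (eqP con) natrD !natrM n0 F0 !mulr0 addr0.
by move/eqP; rewrite oner_eq0.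
Qed.

Section WordAction.

Variables (Omega : finType) (F : finFieldType).
Implicit Types (f : {ffun Omega -> F^o}) (g h : {perm Omega}).

Lemma word_act_is_linear g : linear (fun f => word_act f g).
Proof. by move=> a f1 f2; apply/ffunP=> w; rewrite !ffunE. Qed.

Lemma word_actE f g w : word_act f g (g w) = f w.
Proof. by rewrite ffunE permK. Qed.

Lemma word_actZ a f g : word_act (a *: f) g = a *: word_act f g.
Proof. by apply/ffunP=> w; rewrite !ffunE. Qed.

Lemma word_act_sum (I : finType) (D : {pred I}) (E : I -> {ffun Omega -> F^o}) g :
  word_act (\sum_(i in D) E i) g = \sum_(i in D) word_act (E i) g.
Proof.
apply/ffunP=> w; rewrite ffunE !sum_ffunE.
by apply: eq_bigr => i _; rewrite ffunE.
Qed.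

Definition unit_word (a : Omega) : {ffun Omega -> F^o} :=
  [ffun w => (w == a)%:R].

Lemma word_act_unit a g : word_act (unit_word a) g = unit_word (g a).
Proof.
by apply/ffunP=> w; rewrite !ffunE -(inj_eq (@perm_inj _ g)) permKV.
Qed.

Lemma word_sum_unit f : f = \sum_a f a *: unit_word a.
Proof.
apply/ffunP=> w; rewrite sum_ffunE (bigD1 w) //= big1 => [|a ne_aw].
  by rewrite !ffunE eqxx addr0 /GRing.scale /= mulr1.
by rewrite !ffunE eq_sym (negPf ne_aw) scaler0.
Qed.

(** Stability suffices because [g] acts injectively on words and [C] is finite: the image of [C]
    inside [C] has full cardinality. *)
Lemma PAut_stable (C : {vspace {ffun Omega -> F^o}}) g :
  (g \in PAut C) <-> (forall f, f \in C -> word_act f g \in C).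
Proof.
rewrite inE /code_act; split=> [/eqP Cg f Cf | Cg].
  have: word_act f g \in [set word_act f g | f in C] by apply: imset_f.
  by rewrite Cg inE.
have inj_g : injective (fun f => word_act f g).
  exact: (act_inj (word_action Omega F)).
rewrite eqEcard card_imset // cardsE leqnn andbT.
by apply/subsetP=> _ /imsetP[f Cf ->]; rewrite inE Cg.
Qed.

End WordAction.

Section Averaging.

Variables (Omega : finType) (F : finFieldType).
Variables (C : {vspace {ffun Omega -> F^o}}) (G : {group {perm Omega}}).
Hypothesis GC : G \subset PAut C.

(** The usual factor 1/|G| is left out; the scalar |G| is cancelled only at the end. *)
Definition average_proj (f : {ffun Omega -> F^o}) : {ffun Omega -> F^o} :=
  \sum_(g in G) word_act (projv C (word_act f g)) g^-1%g.

Lemma average_proj_is_linear : linear average_proj.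
Proof.
move=> a f1 f2; rewrite /average_proj scaler_sumr -big_split /=.
by apply: eq_bigr => g _; rewrite word_act_is_linear linearP word_act_is_linear.
Qed.

HB.instance Definition _ :=
  GRing.isLinear.Build F {ffun Omega -> F^o} {ffun Omega -> F^o} _
    average_proj average_proj_is_linear.

Lemma average_proj_in f : average_proj f \in C.
Proof.
apply: memv_suml => g Gg; have /PAut_stable: g^-1%g \in PAut C.
  by rewrite groupV (subsetP GC).
by apply; apply: memv_proj.
Qed.

Lemma average_proj_id f : f \in C -> average_proj f = #|G|%:R *: f.
Proof.
move=> Cf; rewrite scaler_nat -sumr_const; apply: eq_bigr => g Gg.
have /PAut_stable Cg := subsetP GC g Gg.
rewrite projv_id ?Cg //; exact: (actK (word_action Omega F)).
Qed.

Lemma average_proj_act f k :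
  k \in G -> average_proj (word_act f k) = word_act (average_proj f) k.
Proof.
move=> Gk; rewrite word_act_sum [RHS](reindex_inj (mulgI k)) /=.
apply: eq_big => [g | g _]; first by rewrite groupMl.
by rewrite -!word_actM invMg mulgKV.
Qed.

(** These values are the matrix entries of [average_proj] in the basis of unit words; commuting with
    [G] makes them constant on 2-orbits. *)
Lemma average_proj_two_orbit a b a' b' :
  (a', b') \in orbit (pair_action Omega) G (a, b) ->
  average_proj (unit_word F a') b' = average_proj (unit_word F a) b.
Proof.
case/orbitP=> k Gk [<- <-].
by rewrite -word_act_unit average_proj_act // word_actE.
Qed.

Lemma average_proj_two_orbits_act h f :
  (forall x, pair_act x h \in orbit (pair_action Omega) G x) ->
  average_proj (word_act f h) = word_act (average_proj f) h.
Proof.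
move=> hG; rewrite [f]word_sum_unit word_act_sum.
rewrite !linear_sum word_act_sum; apply: eq_bigr => a _.
rewrite word_actZ !linearZ /= word_actZ word_act_unit.
congr (_ *: _); apply/ffunP=> w.
(* The entries compared are at [(h a, w)] and [(a, h^-1 w)], and [h] sends the second pair to the
   first. *)
by rewrite -[w](permKV h) word_actE (average_proj_two_orbit (hG (a, _))).
Qed.

End Averaging.

Lemma two_equivalent_orbit (Omega : finType) (G H : {group {perm Omega}}) x :
  two_equivalent G H ->
  orbit (pair_action Omega) G x = orbit (pair_action Omega) H x.
Proof.
move=> /eqP eqGH.
have: orbit (pair_action Omega) H x \in two_orbits G.
  by rewrite eqGH; apply: imset_f.
(* The [H]-orbit of [x] is the [G]-orbit of some [y]; it contains [x], so it is the [G]-orbit of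
   [x]. *)
case/imsetP=> y _ eqHG; rewrite eqHG; apply/orbit_eqP.
by rewrite -eqHG orbit_refl.
Qed.

Theorem theorem3p2 (Omega : finType) (F : finFieldType)
    (C : {vspace {ffun Omega -> F^o}}) (G : {group {perm Omega}})
    (GC : G \subset PAut C) (coGq : coprime #|G| #|F|) :
  two_closure G \subset PAut C.
Proof.
(* Since [PAut C] is a group, it is enough to treat the generators, the elements of groups
   2-equivalent to [G]. *)
rewrite gen_subG; apply/bigcupsP=> H eqGH; apply/subsetP=> h Hh.
have hG x : pair_act x h \in orbit (pair_action Omega) G x.
  by rewrite (two_equivalent_orbit x eqGH); apply: (mem_orbit (pair_action _)).
apply/PAut_stable=> f Cf.
have: average_proj C G (word_act f h) \in C by apply: average_proj_in.
rewrite average_proj_two_orbits_act // average_proj_id // word_actZ.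
by rewrite rpredZeq (negPf (natr_coprime_neq0 coGq)).
Qed.
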